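(* Let $d>k\geq 1$ be integers such that $\gcd(k,d)=1$. Let $p$ be an odd prime such that $p\nmid dk(d-k)$, and let $q=p^r$ with $r\geq 1$. For $\lambda\in\mathbb{F}_q^\times$, let $f_\lambda(y)=y^{d-k}(1-y)^k-(d\lambda)^{-d}\in\mathbb{F}_q[y]$, and let $r_q(\lambda)$ be the number of distinct zeros of $f_\lambda(y)$ in $\mathbb{F}_q$. Let $\#D_\lambda^{d,k}$ be the number of points in $\mathbb{P}^1(\mathbb{F}_q)$ on the diagonal hypersurface $D_\lambda^{d,k}: X_1^d+X_2^d=d\lambda X_1^kX_2^{d-k}$. Then $r_q(\lambda)=\#D_\lambda^{d,k}$.
   Context: $\mathbb{F}_q$ is the finite field with $q$ elements. $\#D_\lambda^{d,k}$ is the number of points $[X_1:X_2]\in\mathbb{P}^1(\mathbb{F}_q)$ satisfying the homogeneous equation $X_1^d+X_2^d=d\lambda X_1^kX_2^{d-k}$. *)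

(* Defs.v *)
From mathcomp Require Import all_boot all_order all_algebra.

Set Implicit Arguments.
Unset Strict Implicit.
Unset Printing Implicit Defensive.

Import GRing.Theory.
Local Open Scope ring_scope.

Section ProjectiveSpace.
Variable F : finFieldType.

Definition proj_rel n : rel 'rV[F]_n :=
  fun u v => [exists c : F, (c != 0) && (v == c *: u)].

Lemma proj_rel_equiv n : equivalence_rel (@proj_rel n).
Proof.
have refl u : @proj_rel n u u.
  by apply/existsP; exists 1; rewrite oner_eq0 scale1r eqxx.
have sym u v : @proj_rel n u v -> proj_rel v u.
  case/existsP=> c /andP[c0 /eqP->]; apply/existsP; exists c^-1.
  by rewrite invr_eq0 c0 scalerA mulVf // scale1r eqxx.
have trans u v w : @proj_rel n u v -> proj_rel v w -> proj_rel u w.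
  case/existsP=> a /andP[a0 /eqP->] /existsP[b /andP[b0 /eqP->]].
  by apply/existsP; exists (b * a); rewrite mulf_neq0 // scalerA eqxx.
move=> u v w; split=> // uv; apply/idP/idP; first exact/trans/sym.
exact: trans.
Qed.

(* A point of P^n(F) is the set of all its homogeneous coordinate vectors. *)
Definition proj_space n : {set {set 'rV[F]_n.+1}} :=
  equivalence_partition (@proj_rel n.+1) [set v | v != 0].

End ProjectiveSpace.

Section DiagonalHypersurface.
Variables (F : finFieldType) (d k : nat) (lam : F).

Definition diag_eqn (X : 'rV[F]_2) : bool :=
  X 0 0 ^+ d + X 0 1 ^+ d == d%:R * lam * X 0 0 ^+ k * X 0 1 ^+ (d - k).

Lemma diag_eqn_proj (X Y : 'rV[F]_2) :
  (k <= d)%N -> proj_rel X Y -> diag_eqn Y = diag_eqn X.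
Proof.
move=> le_kd /existsP[c /andP[c0 /eqP->]]; rewrite /diag_eqn !mxE !exprMn.
rewrite -mulrDr -!(mulrA (_ * lam)) [_ ^+ k * _ * _]mulrACA.
rewrite -exprD subnKC // [_ * lam * _]mulrCA.
by rewrite (inj_eq (mulfI (expf_neq0 _ c0))).
Qed.

(* By [diag_eqn_proj], asking for all coordinate vectors of P or for one of
   them is the same. *)
Definition diag_hypersurface : {set {set 'rV[F]_2}} :=
  [set P in proj_space F 1 | [forall X in P, diag_eqn X]].

Definition f_poly : {poly F} :=
  'X^(d - k) * (1 - 'X) ^+ k - ((d%:R * lam) ^- d)%:P.

Definition num_zeros : nat := #|[set y : F | root f_poly y]|.

End DiagonalHypersurface.

(* Main.v *)
Require Import Defs.
From mathcomp Require Import all_boot all_order all_algebra.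
From mathcomp Require Import finfield.

Set Implicit Arguments.
Unset Strict Implicit.
Unset Printing Implicit Defensive.

Import GRing.Theory.
Local Open Scope ring_scope.

(** Put [c = d * lam], which is nonzero because the characteristic does not
    divide [d].  A point of the hypersurface has no vanishing coordinate, so it
    is determined by the ratio [t = X_2 / X_1], subject to
    [1 + t^d = c t^(d-k)].  Dividing by [c t^(d-k)] turns this equation into
    [t^k / c + 1 / (c t^(d-k)) = 1], that is, with [y = t^k / c],
    [[
      t^k = c y    and    t^(d-k) = (c (1 - y))^-1.
    ]]
    Eliminating [t] gives [(c y)^(d-k) = (c (1 - y))^-k], that is,
    [f_lam(y) = 0].  Conversely, as [k] and [d - k] are coprime, the
    map [t |-> (t^k, t^(d-k))] is a bijection from the nonzero [t] to the
    nonzero solutions of [u^(d-k) = v^k] (lemmas [monomial_curve_inj] and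
    [monomial_curve_param]), so each zero [y] comes from exactly one [t].  Thus
    both numbers count the solutions [t] of the affine equation
    (lemmas [num_zeros_affine] and [card_diag_affine]). *)

Section MonomialCurve.
Variables (K : fieldType) (a b : nat).
Hypotheses (a_gt0 : (0 < a)%N) (co_ab : coprime a b).

(** By Bezout [m a = n b + 1], so [t = (t^a)^m / (t^b)^n] whenever [t] is
    nonzero. *)
Lemma monomial_curve_inj (t u : K) :
  t != 0 -> u != 0 -> t ^+ a = u ^+ a -> t ^+ b = u ^+ b -> t = u.
Proof.
move=> t0 u0 eq_a eq_b.
case: (egcdnP b a_gt0) => m n; rewrite (eqP co_ab) => bez _.
have e (z : K) : (z ^+ a) ^+ m = (z ^+ b) ^+ n * z.
  by rewrite -!exprM mulnC bez exprD expr1 (mulnC n).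
have tb0 : (t ^+ b) ^+ n != 0 by rewrite !expf_neq0.
by apply: (mulfI tb0); rewrite -e eq_a e eq_b.
Qed.

(** The Bezout formula [t = x^m / y^n], with [m a = n b + 1], recovers the
    parameter: [t^a = x^(m a) / (y^a)^n = x^(n b + 1) / x^(b n) = x], and
    similarly for [y]. *)
Lemma monomial_curve_param (x y : K) :
  x != 0 -> y != 0 -> x ^+ b = y ^+ a -> exists2 t, t ^+ a = x & t ^+ b = y.
Proof.
move=> x0 y0 xy.
case: (egcdnP b a_gt0) => m n; rewrite (eqP co_ab) => bez _.
exists (x ^+ m / y ^+ n); rewrite exprMn exprVn -!exprM.
  rewrite bez exprD expr1 (mulnC n a) (exprM y) -xy -exprM (mulnC n b).
  by rewrite mulrAC mulfV ?mul1r // expf_neq0.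
rewrite (mulnC m b) (exprM x) xy -exprM (mulnC a m) bez exprD expr1.
by rewrite mulrAC mulfV ?mul1r // expf_neq0.
Qed.

End MonomialCurve.

Section Count.
Variables (F : finFieldType) (d k : nat) (lam : F).
Hypotheses (k_gt0 : (0 < k)%N) (lt_kd : (k < d)%N).

Definition chart_point (t : F) : 'rV[F]_2 :=
  \row_i (if i == 0 then 1 else t).

Definition affine_diag : {set F} :=
  [set t | 1 + t ^+ d == d%:R * lam * t ^+ (d - k)].

Let subdk_gt0 : (0 < d - k)%N. Proof. by rewrite subn_gt0. Qed.
Let d_gt0 : (0 < d)%N. Proof. exact: ltn_trans lt_kd. Qed.

Lemma affine_diag_neq0 t : t \in affine_diag -> t != 0.
Proof.
apply: contraTneq => ->.
by rewrite inE !expr0n !gtn_eqF //= mulr0 addr0 oner_eq0.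
Qed.

Lemma chart_point_neq0 t : chart_point t != 0.
Proof. by apply/negP=> /eqP/rowP/(_ 0)/eqP; rewrite !mxE oner_eq0. Qed.

Lemma diag_eqn_chart t : diag_eqn d k lam (chart_point t) = (t \in affine_diag).
Proof. by rewrite inE /diag_eqn !mxE /= !expr1n mulr1. Qed.

Definition proj_class (v : 'rV[F]_2) : {set 'rV[F]_2} :=
  [set w in [set w | w != 0] | proj_rel v w].

(** The first coordinate of a chart vector is [1], so only the scalar [1] can
    relate two of them. *)
Lemma proj_class_chart_inj : injective (proj_class \o chart_point).
Proof.
move=> t u /= eq_tu.
have: chart_point u \in proj_class (chart_point t).
  rewrite eq_tu !inE chart_point_neq0 /=.
  by have [->] := proj_rel_equiv 0 0 (chart_point u).
rewrite !inE => /andP[_ /existsP[c /andP[_ /eqP/rowP eqc]]].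
have := eqc 0; have := eqc 1; rewrite !mxE /= mulr1 => -> <-.
by rewrite mul1r.
Qed.

(** The hypersurface avoids the point [0 : 1], because substituting
    [X_1 = 0] leaves [X_2^d = 0]; hence it lies in the chart [X_1 = 1]. *)
Lemma card_diag_affine : #|diag_hypersurface d k lam| = #|affine_diag|.
Proof.
rewrite -(card_imset affine_diag proj_class_chart_inj).
apply: eq_card => P; apply/idP/imsetP.
  rewrite inE => /andP[/imsetP[v]]; rewrite inE => v0 -> /forall_inP eqn_P.
  have v_in : v \in proj_class v.
    by rewrite !inE v0; have [->] := proj_rel_equiv 0 0 v.
  have eq_v := eqn_P _ v_in.
  have v00 : v 0 0 != 0.
    apply: contraNneq v0 => v00; move: eq_v.
    rewrite /diag_eqn v00 !expr0n !gtn_eqF //= add0r mulr0 mul0r.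
    rewrite expf_eq0 d_gt0 /= => /eqP v01.
    apply/eqP/rowP=> i; rewrite mxE.
    case: (unliftP 0 i) => [j|] -> //.
    by rewrite (ord1 j) -[RHS]v01; congr (v _ _); apply: val_inj.
  have vE : proj_rel v (chart_point (v 0 1 / v 0 0)).
    apply/existsP; exists (v 0 0)^-1; rewrite invr_eq0 v00 /=.
    apply/eqP/rowP=> i; rewrite !mxE.
    case: (unliftP 0 i) => [j|] -> /=; last by rewrite mulVf.
    by rewrite (ord1 j) mulrC; congr (_ * v _ _); apply: val_inj.
  exists (v 0 1 / v 0 0).
    by rewrite -diag_eqn_chart (diag_eqn_proj _ (ltnW lt_kd) vE).
  apply/setP=> w; rewrite !inE; congr (_ && _).
  by have [_ ->] := proj_rel_equiv v (chart_point (v 0 1 / v 0 0)) w.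
case=> t tA ->; rewrite inE; apply/andP; split.
  by apply: imset_f; rewrite inE chart_point_neq0.
apply/forall_inP=> w; rewrite !inE => /andP[_ tw].
by rewrite (diag_eqn_proj _ (ltnW lt_kd) tw) diag_eqn_chart.
Qed.

Hypotheses (co_kd : coprime k d) (c_neq0 : d%:R * lam != 0 :> F).

Let c := d%:R * lam.

(** Multiplying by [c^d = c^(d-k) c^k] absorbs the constant [c^-d] into the two
    factors, which turns the zeros into points of a monomial curve. *)
Lemma root_f_polyE y :
  root (f_poly d k lam) y
  = ((c * y) ^+ (d - k) * (c * (1 - y)) ^+ k == 1).
Proof.
rewrite /root /f_poly !hornerE subr_eq0.
rewrite -/c !(exprMn _ c) mulrACA -exprD subnK ?(ltnW lt_kd) //.
have cd0 : c ^+ d != 0 by rewrite expf_neq0.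
by rewrite -(inj_eq (mulfI cd0)) mulfV.
Qed.

(** The affine equation divided by [t^(d-k)], with [t^k] moved across: it says
    that the parameter [t] of [y = t^k / c] satisfies the second of the two
    monomial conditions, [t^(d-k) = (c (1 - y))^-1]. *)
Lemma mem_affine_diag t : t != 0 ->
  (t \in affine_diag) = (c * (1 - t ^+ k / c) == t ^- (d - k)).
Proof.
move=> t0; rewrite inE.
have tn0 : t ^+ (d - k) != 0 by rewrite expf_neq0.
rewrite mulrBr mulr1 (mulrC c (_ / _)) divfK // -[RHS](inj_eq (mulIf tn0)) mulVf //.
by rewrite mulrBl -exprD subnKC ?(ltnW lt_kd) // subr_eq eq_sym.
Qed.

(** The bijection from affine solutions to zeros is [t |-> t^k / c]; the other
    monomial [t^(d-k)] is then forced to be [(c (1 - y))^-1], and coprimality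
    recovers [t] from the pair. *)
Lemma num_zeros_affine : num_zeros d k lam = #|affine_diag|.
Proof.
have co : coprime k (d - k).
  by rewrite /coprime -(gcdnDl k) subnKC // ltnW.
have inj : {in affine_diag &, injective (fun t => t ^+ k / c)}.
  move=> t u tA uA /= eq_tu.
  have [t0 u0] := (affine_diag_neq0 tA, affine_diag_neq0 uA).
  apply: (monomial_curve_inj k_gt0 co t0 u0).
    by apply: mulIf eq_tu; rewrite invr_eq0.
  apply: invr_inj; move: tA uA; rewrite !mem_affine_diag // eq_tu.
  by move=> /eqP<- /eqP<-.
rewrite -(card_in_imset inj) /num_zeros; apply: eq_card => y.
rewrite inE root_f_polyE; apply/eqP/imsetP => [fy | [t tA ->]]; last first.
  have t0 := affine_diag_neq0 tA.
  move: tA; rewrite mem_affine_diag // => /eqP->.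
  rewrite (mulrC c) divfK // exprVn -!exprM mulnC mulfV //.
  by rewrite expf_neq0.
(* A zero [y] is neither [0] nor [1], so the pair lies on the torus. *)
have : (c * y) ^+ (d - k) * (c * (1 - y)) ^+ k != 0 by rewrite fy oner_eq0.
rewrite mulf_eq0 negb_or !expf_eq0 k_gt0 subdk_gt0 /= => /andP[cy0 c1y0].
have [||t tk tn] := monomial_curve_param k_gt0 co cy0 (y := (c * (1 - y))^-1).
- by rewrite invr_eq0.
- by rewrite exprVn -[RHS]mul1r -[X in _ = X * _]fy mulfK // expf_neq0.
have yE : t ^+ k / c = y by rewrite tk mulrC mulKf.
exists t; last by rewrite yE.
have t0 : t != 0 by move: cy0; rewrite -tk expf_eq0 k_gt0.
by rewrite mem_affine_diag // yE tn invrK.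
Qed.

End Count.

Theorem theorem1p2 (d k p r : nat) (F : finFieldType) (lam : F)
  (hk : (1 <= k)%N) (hkd : (k < d)%N) (hgcd : gcdn k d = 1%N)
  (hp : prime p) (hpodd : odd p) (hpdk : ~~ (p %| d * k * (d - k))%N)
  (hr : (1 <= r)%N) (hF : #|F| = (p ^ r)%N)
  (hlam : lam != 0) :
  num_zeros d k lam = #|diag_hypersurface d k lam|.
Proof.
have d0 : d%:R != 0 :> F.
  rewrite -(dvdn_pcharf (card_finPcharP hF hp)).
  by apply: contra hpdk => /dvdn_mulr pd; rewrite -mulnA pd.
rewrite card_diag_affine // num_zeros_affine //; first exact/eqP.
by rewrite mulf_neq0.
Qed.
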